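(* Let $K$ be a right Bol loop, $G$ a group with identity $e$, and $\chi:\mathcal{H}_r(K)\to G$ a homomorphism of the right inner mapping group of $K$ to $G$. The Schreier extension $K\times_f^{\mathrm{Id}}G$ determined by $$f(\tau,\sigma)=\chi(\rho_{\tau\sigma}^{-1}\rho_\sigma\rho_\tau),\quad \tau,\sigma\in K,\qquad \Theta_\sigma=\mathrm{Id},\quad\sigma\in K,$$ has the following properties: (i) it is a right Bol loop; (ii) it is left nuclear if and only if the image $\chi(\mathcal{H}_r(K))$ is contained in the centre of $G$; (iii) it is a group if and only if $K$ is a group.
   Context: A right Bol loop is a loop satisfying $z(xy\cdot x)=(zx\cdot y)x$. For a loop $K$ with identity $\epsilon$, $\rho_\sigma:K\to K$, $\rho_\sigma x=x\sigma$, is the right translation (compositions are applied right to left); the right inner mapping group $\mathcal{H}_r(K)$ is the group generated by the maps $\rho_{\tau\sigma}^{-1}\rho_\sigma\rho_\tau$, $\sigma,\tau\in K$. For maps $f:K\times K\to G$ and $\Theta:K\to\mathrm{Aut}(G)$ with $f(\sigma,\epsilon)=f(\epsilon,\sigma)=e$ and $\Theta_\epsilon=\mathrm{Id}$, the Schreier extension $K\times_f^{\Theta}G$ is the loop on $K\times G$ with multiplication $(\sigma,s)(\tau,t)=(\sigma\tau,f(\sigma,\tau)\Theta_\tau(s)t)$. It is left nuclear if $\{\epsilon\}\times G$ is contained in the left nucleus $\{u: ux\cdot y=u\cdot xy\ \forall x,y\}$. *)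

(* Defs.v *)
From HB Require Import structures.
From mathcomp Require Import all_boot.
From mathcomp Require Import boolp classical_sets functions.

Set Implicit Arguments.
Unset Strict Implicit.
Unset Printing Implicit Defensive.

Local Open Scope classical_set_scope.
Local Open Scope group_scope.

(* [umagmaType] and [groupType] carry a [choiceType] structure on the underlying
   set; classically every type has one ([gen_eqMixin], [gen_choiceMixin]). *)
HB.mixin Record UMagma_isLoop K of UMagma K := {
  lmul_bij : forall x : K, bijective (fun y : K => x * y);
  rmul_bij : forall x : K, bijective (fun y : K => y * x)
}.

#[short(type="loopType")]
HB.structure Definition Loop := {K of UMagma K & UMagma_isLoop K}.

Definition right_bol (L : loopType) : Prop :=
  forall x y z : L, z * ((x * y) * x) = ((z * x) * y) * x.

Definition left_nucleus (L : loopType) : set L :=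
  [set u | forall x y : L, (u * x) * y = u * (x * y)].

Arguments left_nucleus L : clear implicits.

(* The unit laws are part of [loopType]. *)
Definition is_group (L : loopType) : Prop :=
  associative (@mul L) /\
  exists inv : L -> L, left_inverse 1 inv (@mul L) /\ right_inverse 1 inv (@mul L).

Definition center (G : groupType) : set G :=
  [set z | forall g : G, commute z g].

Arguments center G : clear implicits.

Definition generated (G : groupType) (A : set G) : set G :=
  smallest (fun H : set G => group_closed [in H]) A.

Record bijection (T : Type) := Bijection {
  sym_fun :> T -> T;
  sym_bij : bijective sym_fun
}.

Section SymmetricGroup.
Variable T : Type.
Implicit Types s t u : bijection T.

HB.instance Definition _ := gen_eqMixin (bijection T).
HB.instance Definition _ := gen_choiceMixin (bijection T).

Lemma symP s t : s =1 t -> s = t.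
Proof.
case: s t => [f bf] [g bg] /= /funext fg.
by case: g / fg bg => bg; rewrite (Prop_irrelevance bf bg).
Qed.

Lemma sym_inv_exists s : exists g : T -> T, cancel s g /\ cancel g s.
Proof. by case: (sym_bij s) => g sK gK; exists g. Qed.

Definition sym_inv_fun s : T -> T := projT1 (cid (sym_inv_exists s)).

Lemma sym_funK s : cancel s (sym_inv_fun s).
Proof. by rewrite /sym_inv_fun; case: cid => g []. Qed.

Lemma sym_inv_funK s : cancel (sym_inv_fun s) s.
Proof. by rewrite /sym_inv_fun; case: cid => g []. Qed.

Definition sym_one : bijection T := @Bijection T id (Bijective (fun=> erefl) (fun=> erefl)).
Definition sym_inv s : bijection T :=
  Bijection (Bijective (@sym_inv_funK s) (@sym_funK s)).
(* Right-to-left composition: [s * t] applies [t] first. *)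
Definition sym_mul s t : bijection T := Bijection (bij_comp (sym_bij s) (sym_bij t)).

Lemma sym_mulA : associative sym_mul.
Proof. by move=> s t u; apply: symP. Qed.
Lemma sym_mul1s : left_id sym_one sym_mul.
Proof. by move=> s; apply: symP. Qed.
Lemma sym_muls1 : right_id sym_one sym_mul.
Proof. by move=> s; apply: symP. Qed.
Lemma sym_mulVs : left_inverse sym_one sym_inv sym_mul.
Proof. by move=> s; apply: symP => x /=; rewrite sym_funK. Qed.
Lemma sym_mulsV : right_inverse sym_one sym_inv sym_mul.
Proof. by move=> s; apply: symP => x /=; rewrite sym_inv_funK. Qed.

HB.instance Definition _ := isGroup.Build (bijection T)
  sym_mulA sym_mul1s sym_muls1 sym_mulVs sym_mulsV.

End SymmetricGroup.

Definition rho (K : loopType) (s : K) : bijection K := Bijection (rmul_bij s).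

Definition right_inner (K : loopType) (t s : K) : bijection K :=
  (rho (t * s))^-1 * rho s * rho t.

Definition right_inner_set (K : loopType) : set (bijection K) :=
  generated [set right_inner p.1 p.2 | p in [set: K * K]].

Arguments right_inner_set K : clear implicits.

Lemma right_inner_set_closed (K : loopType) :
  group_closed [in right_inner_set K].
Proof.
split=> [|x y /set_mem Hx /set_mem Hy]; apply/mem_set => H [HH sH].
  by apply/set_mem; case: HH.
apply/set_mem; case: (HH) => _; apply; apply/mem_set.
  exact: (Hx H (conj HH sH)).
exact: (Hy H (conj HH sH)).
Qed.

Lemma mem_right_inner (K : loopType) (t s : K) :
  right_inner t s \in right_inner_set K.
Proof. by rewrite inE => H [_]; apply; exists (t, s). Qed.

Definition right_inner_group (K : loopType) : Type :=
  {h : bijection K | h \in right_inner_set K}.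

HB.instance Definition _ (K : loopType) := SubChoice.on (right_inner_group K).
HB.instance Definition _ (K : loopType) :=
  SubChoice_isSubGroup.Build (bijection K) [in right_inner_set K]
    (right_inner_group K) (@right_inner_set_closed K).

Definition right_inner_elt (K : loopType) (t s : K) : right_inner_group K :=
  exist _ (right_inner t s) (mem_right_inner t s).

Record automorphism (G : groupType) := Automorphism {
  aut_fun :> {multiplicative G -> G};
  aut_bij : bijective aut_fun
}.

Definition aut_id (G : groupType) : automorphism G :=
  @Automorphism G (idfun : {multiplicative G -> G})
    (Bijective (fun=> erefl) (fun=> erefl)).

Record schreier_data (K : loopType) (G : groupType) := SchreierData {
  cocycle : K -> K -> G;
  twist : K -> automorphism G;
  cocycle_1r : forall s, cocycle s 1 = 1;
  cocycle_1l : forall s, cocycle 1 s = 1;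
  twist_1 : twist 1 = aut_id G
}.

(* An alias of [K * G], hiding its componentwise product. *)
Definition schreier (K : loopType) (G : groupType) (D : schreier_data K G) : Type :=
  (K * G)%type.

Section SchreierExtension.
Variables (K : loopType) (G : groupType) (D : schreier_data K G).

HB.instance Definition _ := Choice.copy (schreier D) (K * G)%type.

Definition schreier_one : schreier D := (1, 1).

Definition schreier_mul (x y : schreier D) : schreier D :=
  (x.1 * y.1, cocycle D x.1 y.1 * twist D y.1 x.2 * y.2).

HB.instance Definition _ := hasMul.Build (schreier D) schreier_mul.

Lemma schreier_mul1 : left_id schreier_one schreier_mul.
Proof.
case=> s a; rewrite /schreier_mul /= mul1g cocycle_1l mul1g.
suff -> : twist D s 1 = 1 by rewrite mul1g.
by apply: (@mulgI _ (twist D s 1)); rewrite -gmulfM !mulg1.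
Qed.

Lemma schreier_mulr1 : right_id schreier_one schreier_mul.
Proof.
by case=> s a; rewrite /schreier_mul /= mulg1 cocycle_1r twist_1 /= mul1g mulg1.
Qed.

HB.instance Definition _ :=
  Magma_isUMagma.Build (schreier D) schreier_mul1 schreier_mulr1.

Lemma schreier_lmul_bij (x : schreier D) : bijective (fun y : schreier D => x * y).
Proof.
have [g gK Kg] := lmul_bij x.1.
exists (fun z : schreier D =>
  (g z.1, (cocycle D x.1 (g z.1) * twist D (g z.1) x.2)^-1 * z.2)) => [[t b]|[t b]].
  by congr pair => /=; rewrite ?gK ?mulKg.
by congr pair => /=; rewrite ?Kg ?mulVKg.
Qed.

Lemma schreier_rmul_bij (x : schreier D) : bijective (fun y : schreier D => y * x).
Proof.
have [g gK Kg] := rmul_bij x.1; have [h hK Kh] := aut_bij (twist D x.1).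
exists (fun z : schreier D =>
  (g z.1, h ((cocycle D (g z.1) x.1)^-1 * (z.2 * x.2^-1)))) => [[t b]|[t b]].
  by congr pair => /=; rewrite ?gK ?mulgK ?mulKg ?hK.
by congr pair => /=; rewrite ?Kg ?Kh ?mulVKg ?mulgVK.
Qed.

HB.instance Definition _ :=
  UMagma_isLoop.Build (schreier D) schreier_lmul_bij schreier_rmul_bij.

Definition left_nuclear : Prop :=
  ([set 1] `*` [set: G] : set (schreier D)) `<=` left_nucleus (schreier D).

End SchreierExtension.

Section InnerData.
Variables (K : loopType) (G : groupType) (chi : {multiplicative right_inner_group K -> G}).

Definition inner_cocycle (t s : K) : G := chi (right_inner_elt t s).

Let chi1 : chi 1 = 1.
Proof. by apply: (@mulgI _ (chi 1)); rewrite -gmulfM !mulg1. Qed.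

Let rho1 : rho (1 : K) = 1.
Proof. by apply: symP => x /=; rewrite mulg1. Qed.

Lemma inner_cocycle_1r s : inner_cocycle s 1 = 1.
Proof.
rewrite -chi1; congr (chi _); apply: val_inj.
by rewrite /= /right_inner mulg1 rho1 mulg1 mulVg.
Qed.

Lemma inner_cocycle_1l s : inner_cocycle 1 s = 1.
Proof.
rewrite -chi1; congr (chi _); apply: val_inj.
by rewrite /= /right_inner mul1g rho1 mulg1 mulVg.
Qed.

Definition inner_data : schreier_data K G :=
  @SchreierData K G inner_cocycle (fun=> aut_id G)
    inner_cocycle_1r inner_cocycle_1l erefl.

End InnerData.

(* Main.v *)
Require Import Defs.
From HB Require Import structures.
From mathcomp Require Import all_boot.
From mathcomp Require Import boolp classical_sets functions.

Set Implicit Arguments.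
Unset Strict Implicit.
Unset Printing Implicit Defensive.

Local Open Scope classical_set_scope.
Local Open Scope group_scope.

(** The Bol identity says [rho (x y . x) = rho x rho y rho x].  Hence the
    products of inner maps arising from the two sides of the Bol identity of the
    extension telescope: [f(xy, x) f(x, y) = e] and
    [f(zx . y, x) f(zx, y) f(z, x) = f(z, xy . x)].  Left nuclearity says that the
    values of [f], which generate the image of [chi], are central; and if [K] is
    associative then all right inner maps, hence [f], are trivial. *)

Lemma rho_right_bol (K : loopType) (hK : right_bol K) (x y : K) :
  rho (x * y * x) = rho x * rho y * rho x.
Proof. by apply: symP => z /=; exact: hK. Qed.

Lemma right_inner_eq1 (K : loopType) (x y : K) :
  @associative K mul -> right_inner x y = 1.
Proof.
move=> A; rewrite /right_inner.
have -> : rho (x * y) = rho y * rho x by apply: symP => z /=; exact: A.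
by rewrite -mulgA mulVg.
Qed.

(** The [val]-images of the elements satisfying [P] form a subgroup of [bijection K] containing the
    generators, so they exhaust the right inner mappings. *)
Lemma right_inner_ind (K : loopType) (P : right_inner_group K -> Prop) :
  P 1 -> (forall g h, P g -> P h -> P (g / h)) ->
  (forall x y, P (right_inner_elt x y)) -> forall h, P h.
Proof.
move=> P1 PV Pelt h; have hin := valP h.
pose H : set (bijection K) := [set b | exists2 g, val g = b & P g].
suff [g /val_inj <-] : H (val h) by [].
move: hin => /set_mem; apply; split=> [|_ [[x y] _ <-]].
  split=> [|_ _ /set_mem[a <- Pa] /set_mem[b <- Pb]]; apply/mem_set.
    by exists 1.
  by exists (a / b); [|exact: PV].
by exists (right_inner_elt x y).
Qed.

Section InnerExtension.
Variables (K : loopType) (G : groupType).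
Variable chi : {multiplicative right_inner_group K -> G}.

Local Notation f := (inner_cocycle chi).

Lemma chi1 : chi 1 = 1.
Proof. by apply: (@mulgI _ (chi 1)); rewrite -gmulfM !mulg1. Qed.

Lemma inner_extension_mulE (x y : schreier (inner_data chi)) :
  x * y = (x.1 * y.1, f x.1 y.1 * x.2 * y.2).
Proof. by []. Qed.

(** The middle factors [rho (x * y)] cancel, leaving [chi] of [(rho (x * y * x))^-1 * rho x * rho y
    * rho x]. *)
Lemma inner_cocycle_bol1 (hK : right_bol K) (x y : K) : f (x * y) x * f x y = 1.
Proof.
rewrite /inner_cocycle -gmulfM -chi1; congr (chi _); apply: val_inj => /=.
by rewrite /right_inner rho_right_bol // !mulgA mulgK -!mulgA mulVg.
Qed.

(** Two cancellations leave [(rho (z * x * y * x))^-1 * rho x * rho y * rho x * rho z] under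
    [chi]. *)
Lemma inner_cocycle_bol (hK : right_bol K) (x y z : K) :
  f (z * x * y) x * f (z * x) y * f z x = f z (x * y * x).
Proof.
rewrite /inner_cocycle -!gmulfM; congr (chi _); apply: val_inj => /=.
by rewrite /right_inner !mulgA !mulgK hK rho_right_bol // !mulgA.
Qed.

Lemma inner_extension_bol (hK : right_bol K) : right_bol (schreier (inner_data chi)).
Proof.
move=> [x s] [y t] [z w]; rewrite !inner_extension_mulE /= hK.
congr pair; rewrite -(inner_cocycle_bol hK) !mulgA.
(* The two sides now differ only by [f (x * y) x * f x y] standing between [w] and [s]. *)
by rewrite -(mulgA _ (f (x * y) x)) inner_cocycle_bol1 // mulg1.
Qed.

Lemma left_nuclear_cocycle :
  left_nuclear (inner_data chi) <-> forall x y, center G (f x y).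
Proof.
split=> [N x y g|C [_ s] [/= -> _] [x t] [y w]].
  (* On this triple the second coordinates of the two sides are [f x y * g] and [g * f x y]. *)
  have /(_ (1, g) (conj erefl I) (x, 1) (y, 1)) := N.
  by rewrite !inner_extension_mulE /= !inner_cocycle_1l !mul1g !mulg1 => -[].
rewrite !inner_extension_mulE /= !inner_cocycle_1l !mul1g; congr pair.
by rewrite !mulgA (C x y s).
Qed.

Lemma center_range_cocycle :
  range chi `<=` center G <-> forall x y, center G (f x y).
Proof.
split=> [C x y|C _ [h _ <-]]; first by apply: C; exists (right_inner_elt x y).
elim/right_inner_ind: h => [|g h Cg Ch|x y]; last exact: C.
  by rewrite chi1 => k; exact/commute_sym/commute1.
have -> : chi (g / h) = chi g / chi h.
  by apply: (@mulIg _ (chi h)); rewrite -gmulfM !mulgVK.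
by move=> k; apply/commute_sym/commuteM; [|apply/commuteV]; exact/commute_sym.
Qed.

Lemma inner_extension_group :
  is_group (schreier (inner_data chi)) <-> is_group K.
Proof.
split=> [[A [inv [Vl Vr]]]|[A [inv [Vl Vr]]]].
  (* The first projection is a surjective homomorphism onto [K], so the group laws descend. *)
  split=> [x y z|]; first by have [] := A (x, 1) (y, 1) (z, 1).
  exists (fun x => (inv (x, 1)).1); split=> x.
    by have [] := Vl (x, 1).
  by have [] := Vr (x, 1).
have f1 x y : f x y = 1.
  by rewrite -chi1; congr (chi _); apply/val_inj/right_inner_eq1.
(* With [f] trivial the extension is the direct product of [K] and [G]. *)
split=> [[x s] [y t] [z w]|].
  by rewrite !inner_extension_mulE /= !f1 !mul1g A mulgA.
exists (fun x => (inv x.1, x.2^-1)); split=> -[x s];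
  rewrite inner_extension_mulE /= f1 mul1g.
  by rewrite Vl mulVg.
by rewrite Vr mulgV.
Qed.

End InnerExtension.

Theorem proposition33 (K : loopType) (hK : right_bol K) (G : groupType)
    (chi : {multiplicative right_inner_group K -> G}) :
  [/\ right_bol (schreier (inner_data chi)),
      left_nuclear (inner_data chi) <-> range chi `<=` center G
    & is_group (schreier (inner_data chi)) <-> is_group K].
Proof.
split; [exact: inner_extension_bol | | exact: inner_extension_group].
by rewrite left_nuclear_cocycle center_range_cocycle.
Qed.
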